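(* Let $n,p$ be positive integers, and let $(\phi_k)_{k=0}^\infty\subset\mathbb{R}^{p\times n}$ be persistently exciting with $N,\alpha,\beta$ as in the definition of persistent excitation. Let $R\in\mathbb{R}^{n\times n}$ be positive definite, define $P_0=R^{-1}$, let $\lambda\in(0,1)$ and $\varepsilon>0$, and, for all $k\ge0$, let $P_{k+1}$ be given by $$P_{k+1}^{-1}=\Lambda_kP_k^{-1}\Lambda_k+\phi_k^{\mathrm T}\phi_k,$$ where $\Lambda_k$ is the variable-direction forgetting matrix determined by $P_k,\phi_k,\lambda,\varepsilon$ (defined in the context). Then, for all $k\ge N+1$, $$\frac{\lambda^N(1-\lambda)\alpha}{1-\lambda^{N+1}}I_n\le P_k^{-1}.$$
   Context: Matrix inequalities are in the sense of symmetric matrices ($A\le B$ means $B-A$ is positive semidefinite); positive definite matrices are real symmetric. Persistent excitation: a sequence $(\phi_k)_{k=0}^\infty\subset\mathbb{R}^{p\times n}$ is persistently exciting if there exist an integer $N\ge n/p$ and $\alpha,\beta\in(0,\infty)$ such that, for all $j\ge0$, $\alpha I_n\le\sum_{i=j}^{j+N}\phi_i^{\mathrm T}\phi_i\le\beta I_n$. Variable-direction forgetting matrix: for each $k\ge0$, given the positive definite matrix $P_k\in\mathbb{R}^{n\times n}$, let $P_k^{-1}=U_k\Sigma_kU_k^{\mathrm T}$ be a singular value decomposition, where $U_k\in\mathbb{R}^{n\times n}$ is an orthogonal matrix whose columns are singular vectors of $P_k^{-1}$ and $\Sigma_k$ is the diagonal matrix of corresponding singular values. Set $\psi_k=\phi_kU_k\in\mathbb{R}^{p\times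 n}$, and let $\overline\Lambda_k\in\mathbb{R}^{n\times n}$ be the diagonal matrix with $\overline\Lambda_k(i,i)=\sqrt\lambda$ if $\|\mathrm{col}_i(\psi_k)\|>\varepsilon$ and $\overline\Lambda_k(i,i)=1$ otherwise, where $\mathrm{col}_i(\psi_k)$ is the $i$th column of $\psi_k$ and $\|\cdot\|$ is the Euclidean norm. Then $\Lambda_k=U_k\overline\Lambda_kU_k^{\mathrm T}$. *)

(* Defs.v *)
From HB Require Import structures.
From mathcomp Require Import all_boot all_order all_algebra.
From mathcomp Require Import reals.

Set Implicit Arguments.
Unset Strict Implicit.
Unset Printing Implicit Defensive.

Import Order.TTheory GRing.Theory Num.Theory.
Local Open Scope ring_scope.

Definition is_psd (R : realType) (n : nat) (A : 'M[R]_n) : Prop :=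
  A \is symmetricmx /\ forall x : 'cV[R]_n, 0 <= (x^T *m A *m x) 0 0.

Definition is_posdef (R : realType) (n : nat) (A : 'M[R]_n) : Prop :=
  A \is symmetricmx /\
  forall x : 'cV[R]_n, x != 0 -> 0 < (x^T *m A *m x) 0 0.

Definition loewner_le (R : realType) (n : nat) (A B : 'M[R]_n) : Prop :=
  is_psd (B - A).

(* The matrix norm of MathComp-Analysis is the sup norm, hence this one. *)
Definition euclid_norm (R : realType) (m : nat) (x : 'cV[R]_m) : R :=
  Num.sqrt (\sum_(i < m) x i 0 ^+ 2).

Definition persistently_exciting (R : realType) (n p : nat)
    (phi : nat -> 'M[R]_(p, n)) (N : nat) (alpha beta : R) : Prop :=
  [/\ n%:R / p%:R <= N%:R :> R, 0 < alpha, 0 < beta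
    & forall j : nat,
        loewner_le alpha%:M (\sum_(j <= i < (j + N).+1) (phi i)^T *m phi i) /\
        loewner_le (\sum_(j <= i < (j + N).+1) (phi i)^T *m phi i) beta%:M].

Definition is_orthogonal (R : realType) (n : nat) (U : 'M[R]_n) : Prop :=
  U^T *m U = 1%:M.

(* No ordering is imposed on the singular values. *)
Definition is_svd (R : realType) (n : nat) (A U Sigma V : 'M[R]_n) : Prop :=
  [/\ is_orthogonal U, is_orthogonal V, is_diag_mx Sigma,
      forall i : 'I_n, 0 <= Sigma i i
    & A = U *m Sigma *m V^T].

Definition vdf_diag (R : realType) (n p : nat) (psi : 'M[R]_(p, n))
    (lambda eps : R) : 'M[R]_n :=
  diag_mx (\row_(i < n)
    if eps < euclid_norm (col i psi) then Num.sqrt lambda else 1).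

(* A relation rather than a function of P, phi, lambda and eps, because the
   singular value decomposition of P^-1 is not unique. *)
Definition is_vdf_matrix (R : realType) (n p : nat) (P : 'M[R]_n)
    (phi : 'M[R]_(p, n)) (lambda eps : R) (Lambda : 'M[R]_n) : Prop :=
  exists U Sigma : 'M[R]_n,
    is_svd (invmx P) U Sigma U /\
    Lambda = U *m vdf_diag (phi *m U) lambda eps *m U^T.

(* Main.v *)
Require Import Defs.
From HB Require Import structures.
From mathcomp Require Import all_boot all_order all_algebra.
From mathcomp Require Import reals.

Set Implicit Arguments.
Unset Strict Implicit.
Unset Printing Implicit Defensive.

Import Order.TTheory GRing.Theory Num.Theory.
Local Open Scope ring_scope.

(** In an orthonormal basis of eigenvectors of [A_k = P_k^-1] the forgetting
    step is diagonal: it multiplies each eigenvalue of [A_k] by [lambda] or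
    by [1], because [Lambda_k] is diagonal in that same basis.  Hence
    [lambda A_k <= Lambda_k A_k Lambda_k]: forgetting in some directions only
    loses no more than uniform exponential forgetting does
    ([loewner_le_vdf_step]), and
    [lambda A_k + phi_k^T phi_k <= A_(k+1)].

    Unrolling this inequality over a window of [N + 1] steps, and discarding
    the contribution [lambda^(N+1) A_(k-N-1) >= 0] of the start of the window,
    leaves the sum of [lambda^(k-1-i) phi_i^T phi_i] over the window, where
    every weight is at least [lambda^N].  Persistent excitation then gives
    [lambda^N alpha I <= A_k] ([loewner_le_window_sum]).  This is stronger than
    the announced bound, since [(1 - lambda) / (1 - lambda^(N+1)) <= 1]. *)

Lemma symmetricmxP (R : realType) (n : nat) (A : 'M[R]_n) :
  A \is symmetricmx <-> A^T = A.
Proof.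
by rewrite is_hermitianmxE expr0 scale1r map_mx_id // eq_sym; split=> /eqP.
Qed.

Lemma is_psdD (R : realType) (n : nat) (A B : 'M[R]_n) :
  is_psd A -> is_psd B -> is_psd (A + B).
Proof.
move=> [/symmetricmxP sA pA] [/symmetricmxP sB pB]; split.
  by apply/symmetricmxP; rewrite linearD /= sA sB.
by move=> x; rewrite mulmxDr mulmxDl mxE addr_ge0.
Qed.

Lemma is_psdZ (R : realType) (n : nat) (c : R) (A : 'M[R]_n) :
  0 <= c -> is_psd A -> is_psd (c *: A).
Proof.
move=> c0 [/symmetricmxP sA pA]; split.
  by apply/symmetricmxP; rewrite linearZ /= sA.
by move=> x; rewrite -scalemxAr -scalemxAl mxE mulr_ge0.
Qed.

Lemma is_psd_congr (R : realType) (m n : nat) (M : 'M[R]_(m, n))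
    (A : 'M[R]_m) :
  is_psd A -> is_psd (M^T *m A *m M).
Proof.
move=> [/symmetricmxP sA pA]; split.
  by apply/symmetricmxP; rewrite !trmx_mul trmxK sA mulmxA.
by move=> x; have := pA (M *m x); rewrite trmx_mul !mulmxA.
Qed.

Lemma is_psd_diag (R : realType) (n : nat) (d : 'rV[R]_n) :
  (forall i, 0 <= d 0 i) -> is_psd (diag_mx d).
Proof.
move=> d0; split; first by apply/symmetricmxP; rewrite tr_diag_mx.
move=> x; rewrite mul_mx_diag mxE; apply: sumr_ge0 => i _.
by rewrite !mxE mulrAC mulr_ge0 // -expr2 sqr_ge0.
Qed.

Lemma is_psd_scalar (R : realType) (n : nat) (c : R) :
  0 <= c -> is_psd (c%:M : 'M[R]_n).
Proof.
by move=> c0; rewrite -diag_const_mx; apply: is_psd_diag => i; rewrite mxE.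
Qed.

Lemma is_psd_gram (R : realType) (m n : nat) (M : 'M[R]_(m, n)) :
  is_psd (M^T *m M).
Proof. by rewrite -[M^T]mulmx1; apply/is_psd_congr/is_psd_scalar/ler01. Qed.

Lemma loewner_le_refl (R : realType) (n : nat) (A : 'M[R]_n) : loewner_le A A.
Proof. by rewrite /loewner_le subrr -(raddf0 (@scalar_mx R n)); apply: is_psd_scalar. Qed.

Lemma loewner_le_trans (R : realType) (n : nat) (B A C : 'M[R]_n) :
  loewner_le A B -> loewner_le B C -> loewner_le A C.
Proof.
by move=> AB BC; rewrite /loewner_le -(subrKA B); apply: is_psdD.
Qed.

Lemma loewner_leD (R : realType) (n : nat) (A B C D : 'M[R]_n) :
  loewner_le A B -> loewner_le C D -> loewner_le (A + C) (B + D).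
Proof. by move=> AB CD; rewrite /loewner_le opprD addrACA; apply: is_psdD. Qed.

Lemma loewner_leZ (R : realType) (n : nat) (c : R) (A B : 'M[R]_n) :
  0 <= c -> loewner_le A B -> loewner_le (c *: A) (c *: B).
Proof. by move=> c0 AB; rewrite /loewner_le -scalerBr; apply: is_psdZ. Qed.

Lemma loewner_leZr (R : realType) (n : nat) (a b : R) (A : 'M[R]_n) :
  a <= b -> is_psd A -> loewner_le (a *: A) (b *: A).
Proof.
by move=> ab pA; rewrite /loewner_le -scalerBl; apply: is_psdZ; rewrite ?subr_ge0.
Qed.

(** With equal left and right singular vectors the singular values are
    eigenvalues.  The decomposition defining [Lambda_k] thus shows on its own
    that [P_k^-1] is positive semidefinite, with no induction on [k]. *)
Lemma is_psd_svd (R : realType) (n : nat) (A U Sigma : 'M[R]_n) :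
  is_svd A U Sigma U -> is_psd A.
Proof.
move=> [_ _ /diag_mxP [s ->] s0 ->].
rewrite -{1}[U]trmxK; apply/is_psd_congr/is_psd_diag => i.
by have := s0 i; rewrite mxE eqxx.
Qed.

(** Both [Lambda] and [P^-1] are diagonal in the basis [U], so the comparison
    is one of eigenvalues: those of [P^-1] are nonnegative and get multiplied
    by the square of a diagonal entry of [vdf_diag], which is [lambda] or
    [1]. *)
Lemma loewner_le_vdf_step (R : realType) (n p : nat) (P : 'M[R]_n)
    (phi : 'M[R]_(p, n)) (lambda eps : R) (Lambda : 'M[R]_n) :
  0 <= lambda <= 1 -> is_vdf_matrix P phi lambda eps Lambda ->
  loewner_le (lambda *: invmx P) (Lambda *m invmx P *m Lambda).
Proof.
move=> /andP [l0 l1] [U [_ [[oU _ /diag_mxP [s ->] s0 ->] ->]]].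
rewrite /vdf_diag; set d := \row_(i < n) _.
rewrite !mulmxA -!(mulmxA _ U^T U) oU !mulmx1.
rewrite /loewner_le scalemxAl scalemxAr -mulmxBl -(mulmxA U) -(mulmxA U).
rewrite -mulmxBr -{1}[U]trmxK !mulmx_diag -linearZ -linearB /=.
apply/is_psd_congr/is_psd_diag => i.
have := s0 i; rewrite !mxE eqxx mulr1n => si0.
rewrite mulrAC -mulrBl mulr_ge0 // subr_ge0.
by case: ifP => _; rewrite -expr2 ?sqr_sqrtr // expr1n.
Qed.

(** Unrolling the recursion weights [G i] by a power of [lambda] of exponent at
    most [m]; as [lambda <= 1], all these weights are at least
    [lambda ^+ m]. *)
Lemma loewner_le_window_sum (R : realType) (n : nat) (lambda : R)
    (A G : nat -> 'M[R]_n) :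
  0 <= lambda <= 1 -> (forall k, is_psd (A k)) -> (forall k, is_psd (G k)) ->
  (forall k, loewner_le (lambda *: A k + G k) (A k.+1)) ->
  forall j m,
    loewner_le (lambda ^+ m *: \sum_(j <= i < (j + m).+1) G i) (A (j + m).+1).
Proof.
move=> /andP [l0 l1] pA pG step j; elim=> [|m IHm].
  rewrite addn0 big_nat1 expr0 -[1 *: _]add0r scale1r.
  apply: loewner_le_trans (step j); apply: loewner_leD.
    by rewrite /loewner_le subr0; apply: is_psdZ.
  exact: loewner_le_refl.
rewrite addnS big_nat_recr /=; last by rewrite leqW // leq_addr.
rewrite scalerDr; apply: loewner_le_trans (step _); apply: loewner_leD.
  by rewrite exprS -scalerA; apply: loewner_leZ.
by rewrite -[G _ in X in loewner_le _ X]scale1r; apply: loewner_leZr => //;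
  apply: exprn_ile1.
Qed.

Theorem proposition10 (R : realType) (n p : nat)
    (hn : (0 < n)%N) (hp : (0 < p)%N)
    (phi : nat -> 'M[R]_(p, n)) (N : nat) (alpha beta : R)
    (hphi : persistently_exciting phi N alpha beta)
    (R0 : 'M[R]_n) (hR0 : is_posdef R0)
    (lambda eps : R) (hlambda0 : 0 < lambda) (hlambda1 : lambda < 1)
    (heps : 0 < eps)
    (P Lambda : nat -> 'M[R]_n)
    (hP0 : P 0%N = invmx R0)
    (hLambda : forall k : nat,
        is_vdf_matrix (P k) (phi k) lambda eps (Lambda k))
    (hP : forall k : nat,
        invmx (P k.+1) =
        Lambda k *m invmx (P k) *m Lambda k + (phi k)^T *m phi k)
    (k : nat) (hk : (N.+1 <= k)%N) :
  loewner_le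
    ((lambda ^+ N * (1 - lambda) * alpha / (1 - lambda ^+ N.+1))%:M)
    (invmx (P k)).
Proof.
have l01 : 0 <= lambda <= 1 by rewrite !ltW.
have lN0 : 0 <= lambda ^+ N by rewrite exprn_ge0 // ltW.
have pP i : is_psd (invmx (P i)).
  by have [U [S [svdP _]]] := hLambda i; apply: is_psd_svd svdP.
have pG i : is_psd ((phi i)^T *m phi i) by apply: is_psd_gram.
have step i :
    loewner_le (lambda *: invmx (P i) + (phi i)^T *m phi i) (invmx (P i.+1)).
  rewrite hP; apply: loewner_leD; first exact: loewner_le_vdf_step (hLambda i).
  exact: loewner_le_refl.
have [j ->] : exists j, k = (j + N).+1.
  by exists (k - N.+1)%N; rewrite -addnS subnK.
have [_ alpha0 _ /(_ j) [exc _]] := hphi.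
apply: loewner_le_trans (loewner_le_window_sum l01 pP pG step j N).
apply: loewner_le_trans (loewner_leZ lN0 exc).
rewrite scale_scalar_mx /loewner_le -raddfB /=; apply: is_psd_scalar.
(* The factor (1 - lambda) / (1 - lambda ^+ N.+1) is at most 1. *)
have lN1 : lambda ^+ N.+1 < 1 by rewrite exprn_ilt1 // ltW.
rewrite subr_ge0 ler_pdivrMr ?subr_gt0 // mulrAC ler_wpM2l //.
  by rewrite mulr_ge0 // ltW.
by rewrite lerD2l lerN2 ler_iXnr // ltW.
Qed.
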